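(* Let $d > 2$ be an integer. There exists a constant $C > 0$, depending at most on $d$ (in particular independent of $q$ and $E$), such that the following holds. Let $q$ be an integer with prime decomposition $q = p_1^{\alpha_1} \cdots p_k^{\alpha_k}$, where $k \geq 1$, $2 < p_1 < \dots < p_k$ are primes and $\alpha_i > 0$ for each $i = 1, \dots, k$. Let $\tau(q) = \sum_{e \mid q} 1$ be the number of positive divisors of $q$. If $E \subset \mathbb{Z}_q^d$ satisfies $$|E| \geq C\, \tau(q)\, q^d\, p_1^{-\frac{d-2}{2}},$$ then $\Delta(E) = \mathbb{Z}_q$.
   Context: $\mathbb{Z}_q$ denotes the ring of integers modulo $q$, and $\mathbb{Z}_q^d = \mathbb{Z}_q \times \dots \times \mathbb{Z}_q$ is the free module of rank $d$ over $\mathbb{Z}_q$. For $x = (x_1,\dots,x_d) \in \mathbb{Z}_q^d$ put $\|x\| = x_1^2 + \dots + x_d^2 \in \mathbb{Z}_q$. For $E \subset \mathbb{Z}_q^d$, the distance set is $\Delta(E) = \{\|x-y\| : x, y \in E\} = \{(x_1-y_1)^2 + \dots + (x_d-y_d)^2 : x,y \in E\} \subset \mathbb{Z}_q$. *)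

(* Defs.v *)
From mathcomp Require Import all_boot all_order all_algebra.

Set Implicit Arguments.
Unset Strict Implicit.
Unset Printing Implicit Defensive.

Import GRing.Theory.
Local Open Scope ring_scope.

(* 'Z_q is the ring of integers modulo q only for 1 < q. *)

(* A sum of squares with values in 'Z_q: neither a norm nor a square root. *)
Definition sqnorm (q d : nat) (x : 'rV['Z_q]_d) : 'Z_q :=
  \sum_(i < d) x 0 i ^+ 2.

Definition distance_set (q d : nat) (E : {set 'rV['Z_q]_d}) : {set 'Z_q} :=
  [set sqnorm (x - y) | x in E, y in E].

Definition tau (q : nat) : nat := size (divisors q).

(* Main.v *)
Require Import Defs.
From mathcomp Require Import all_boot all_order all_algebra all_field.
From mathcomp Require Import reals exp.
From mathcomp Require Import ring.

Set Implicit Arguments.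
Unset Strict Implicit.
Unset Printing Implicit Defensive.

Import Order.TTheory GRing.Theory Num.Theory.
Local Open Scope ring_scope.

(* Let chi be a faithful character of Z_q and, for s in Z_q, put
   B s = sum_(x, y in E) chi (s ||x - y||).  If t is not a distance, then
   sum_s chi (- s t) B s = 0, so |E|^2 = B 0 is at most sum_(s != 0) |B s|.
   Writing g = gcd (s, q), Cauchy-Schwarz and orthogonality give
   |B s|^2 <= |E|^2 (g q)^d, and since g <= q / p_1 for s != 0 this yields
   |B s| <= |E| q^(d-1) p_1^(-(d-2)/2) g.  Summing over s with
   sum_(s != 0) gcd (s, q) <= q (tau q - 1) gives
   |E| <= (tau q - 1) q^d p_1^(-(d-2)/2), so C = 1 works. *)

(** * Characters and Cauchy-Schwarz *)

(** Take [a |-> z ^+ a] with [z] a primitive root of unity of order [(Zp_trunc n).+2], the true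
    order of ['Z_n] for every [n]. *)
Lemma exists_faithful_character (n : nat) :
  exists chi : 'Z_n -> algC,
    [/\ forall a b, chi (a + b) = chi a * chi b,
        forall a, `|chi a| = 1
      & forall a, chi a = 1 -> a = 0].
Proof.
have [z prim_z] := C_prim_root_exists (ltn0Sn (Zp_trunc n).+1).
exists (fun a => z ^+ a); split=> [a b|a|a /eqP].
- by rewrite -exprD -(prim_expr_mod prim_z (_ + _)).
- apply/eqP; rewrite -(@pexpr_eq1 _ _ (Zp_trunc n).+2) // -normrX exprAC.
  by rewrite (prim_expr_order prim_z) expr1n normr1.
- rewrite -(expr0 z) (eq_prim_root_expr prim_z) mod0n modn_small ?ltn_ord //.
  by move=> /eqP a0; apply: val_inj.
Qed.

Lemma unit_character0 (V : zmodType) (psi : V -> algC) :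
  (forall x y, psi (x + y) = psi x * psi y) -> (forall x, `|psi x| = 1) ->
  psi 0 = 1.
Proof.
move=> psiD psi_norm; apply: (mulfI (x := psi 0)); last by rewrite mulr1 -psiD addr0.
by rewrite -normr_eq0 psi_norm oner_eq0.
Qed.

(** Translating the variable by [v] multiplies the sum by [psi v], so [psi v - 1] annihilates it. *)
Lemma sum_nontrivial_character (V : finZmodType) (psi : V -> algC) (v : V) :
  (forall x y, psi (x + y) = psi x * psi y) -> psi v != 1 ->
  \sum_x psi x = 0.
Proof.
move=> psiD psi_v.
have: (\sum_x psi x) * (psi v - 1) = 0.
  rewrite mulrBr mulr1 [X in _ - X](reindex_inj (addIr v)) mulr_suml -sumrB.
  by apply: big1 => x _; rewrite psiD subrr.
by move/eqP; rewrite mulf_eq0 subr_eq0 (negbTE psi_v) orbF => /eqP.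
Qed.

(** Both sides are double sums over [A], compared term by term through [(a i - a j) ^+ 2 >= 0];
    nonnegativity of [a] makes the differences real. *)
Lemma sqr_sum_le_card (F : numFieldType) (I : finType) (A : {set I}) (a : I -> F) :
  (forall i, 0 <= a i) ->
  (\sum_(i in A) a i) ^+ 2 <= #|A|%:R * \sum_(i in A) a i ^+ 2.
Proof.
move=> a_ge0; have -> : #|A|%:R * \sum_(i in A) a i ^+ 2 =
    2^-1 * \sum_(i in A) \sum_(j in A) (a i ^+ 2 + a j ^+ 2).
  under [X in _ = _ * X]eq_bigr do rewrite big_split sumr_const /=.
  by rewrite big_split sumr_const /= sumrMnl -mulr_natl; field.
rewrite expr2 mulr_suml mulr_sumr.
apply: ler_sum => i _; rewrite !mulr_sumr; apply: ler_sum => j _.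
rewrite -subr_ge0.
have -> : 2^-1 * (a i ^+ 2 + a j ^+ 2) - a i * a j = 2^-1 * (a i - a j) ^+ 2 by field.
rewrite mulr_ge0 ?invr_ge0 ?ler0n // real_exprn_even_ge0 //.
by rewrite rpredB // ger0_real.
Qed.

(** * Arithmetic and counting in Z_q *)

(** The squares of [x] cancel, so the difference is affine in [x] and a sum over [x] becomes a sum
    of a linear character. *)
Lemma sqnorm_sub_sub (q d : nat) (x y y' : 'rV['Z_q]_d) :
  sqnorm (x - y) - sqnorm (x - y') =
  (sqnorm y - sqnorm y') + \sum_(i < d) x 0 i * (2 * (y' 0 i - y 0 i)).
Proof.
rewrite /sqnorm -!sumrB -big_split /=; apply: eq_bigr => i _.
by rewrite !mxE; ring.
Qed.

Lemma card_multiples (q m : nat) :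
  (1 < q)%N -> (m %| q)%N -> (#|[set c : 'Z_q | (m %| c)%N]| <= q %/ m)%N.
Proof.
move=> q_gt1 m_q; have q_gt0 : (0 < q)%N by apply: ltnW.
have m_gt0 : (0 < m)%N by apply: dvdn_gt0 m_q.
have qm_gt0 : (0 < q %/ m)%N by rewrite divn_gt0 // dvdn_leq.
(* Division by [m] is injective on multiples of [m]; the default of [insubd] is never reached
   there. *)
pose f (c : 'Z_q) : 'I_(q %/ m) := insubd (Ordinal qm_gt0) (c %/ m)%N.
rewrite -[X in (_ <= X)%N]card_ord; apply: (@leq_card_in _ _ f) => c c'.
have fE (b : 'Z_q) : (m %| b)%N -> (f b * m = b)%N.
  move=> m_b; rewrite val_insubd ltn_divRL // divnK //.
  by rewrite -[X in (_ < X)%N](Zp_cast q_gt1) ltn_ord divnK.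
by rewrite !inE => /fE c_m /fE c'_m eq_f; apply: val_inj; rewrite /= -c_m -c'_m eq_f.
Qed.

(** If [q] divides [s * c], it divides [gcdn s q * c], so [c] is a multiple of [q %/ gcdn s q]. *)
Lemma card_annihilator (q : nat) (s : 'Z_q) :
  (1 < q)%N -> (#|[set c : 'Z_q | (s * c == 0)%R]| <= gcdn s q)%N.
Proof.
move=> q_gt1; have q_gt0 : (0 < q)%N by apply: ltnW.
have g_q := dvdn_gcdr s q; have g_gt0 : (0 < gcdn s q)%N by rewrite gcdn_gt0 q_gt0 orbT.
have qg_q : (q %/ gcdn s q %| q)%N by rewrite dvdn_divLR // dvdn_mulr.
have -> : gcdn s q = (q %/ (q %/ gcdn s q))%N by rewrite divnA // mulKn.
apply: leq_trans (card_multiples q_gt1 qg_q); apply/subset_leq_card/subsetP => c.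
rewrite !inE => /eqP/(congr1 val)/= /eqP.
rewrite [X in (_ %% X)%N](Zp_cast q_gt1) => q_sc.
rewrite dvdn_divLR //.
have: (q %| gcdn (s * c) (q * c))%N by rewrite dvdn_gcd [X in X && _]q_sc dvdn_mulr.
by rewrite -muln_gcdl mulnC.
Qed.

(** Bound [gcdn s q] by the sum of all common divisors [g] and exchange sums: each [g] has at most
    [q %/ g] multiples, hence contributes at most [q]. The term [s = 0] equals [q] and accounts for
    the predecessor. *)
Lemma sum_gcd_le (q : nat) :
  (1 < q)%N -> (\sum_(s : 'Z_q | (s != 0)%R) gcdn s q <= (tau q).-1 * q)%N.
Proof.
move=> q_gt1; have q_gt0 : (0 < q)%N by apply: ltnW.
have gcd_le (s : 'Z_q) : (gcdn s q <= \sum_(g <- divisors q) (g %| s) * g)%N.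
  rewrite (bigD1_seq (gcdn s q)) ?divisors_uniq //= ?dvdn_gcdl ?mul1n ?leq_addr //.
  by rewrite -dvdn_divisors // dvdn_gcdr.
have : (\sum_(s : 'Z_q) gcdn s q <= tau q * q)%N.
  apply: (@leq_trans (\sum_(s : 'Z_q) \sum_(g <- divisors q) (g %| s) * g)).
    exact: leq_sum.
  rewrite exchange_big /= /tau -sum1_size big_distrl /=.
  rewrite big_seq [X in (_ <= X)%N]big_seq; apply: leq_sum => g.
  rewrite -dvdn_divisors // mul1n => g_q; rewrite -big_distrl /=.
  rewrite -[X in (_ <= X)%N](divnK g_q) leq_mul2r.
  have -> : (\sum_(s : 'Z_q) (g %| s))%N = #|[set s : 'Z_q | (g %| s)%N]|.
    by rewrite -sum1dep_card [RHS]big_mkcond.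
  by rewrite card_multiples ?orbT.
rewrite (bigD1 (0%R : 'Z_q)) //= gcd0n => sum_le.
rewrite -(leq_add2l q) (leq_trans sum_le) // -mulSn prednK //.
by rewrite /tau; case: divisors (divisor1 q).
Qed.

(** * The exponential sum bound *)

(* After Cauchy-Schwarz in x, the range of x is extended from E to the whole
   module, where the sum over x is orthogonality of characters. *)
Lemma norm_distance_sum_le (q d : nat) (chi : 'Z_q -> algC)
    (E : {set 'rV['Z_q]_d}) (s : 'Z_q) :
  (1 < q)%N -> odd q ->
  (forall a b, chi (a + b) = chi a * chi b) -> (forall a, `|chi a| = 1) ->
  (forall a, chi a = 1 -> a = 0) ->
  `|\sum_(x in E) \sum_(y in E) chi (s * sqnorm (x - y))| ^+ 2 <=
  #|E|%:R ^+ 2 * (gcdn s q * q)%:R ^+ d.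
Proof.
move=> q_gt1 q_odd chiD chi_norm chi_faithful.
have chi_conj a : (chi a)^* = chi (- a).
  have chi0 : chi 0 = 1 := unit_character0 chiD chi_norm.
  apply: (mulfI (x := chi a)); first by rewrite -normr_eq0 chi_norm oner_eq0.
  by rewrite -normCK chi_norm expr1n -chiD subrr.
pose b x := `|\sum_(y in E) chi (s * sqnorm (x - y))|.
(* [K] collects the differences [y - y'] for which the linear character in [x] is trivial. *)
pose K := [set v : 'rV['Z_q]_d | [forall i, s * v 0 i == 0]].
have card_K : (#|K| <= gcdn s q ^ d)%N.
  pose f (v : 'rV['Z_q]_d) := [ffun i => v 0 i].
  have f_inj : injective f.
    by move=> v w /ffunP vw; apply/rowP => i; have := vw i; rewrite !ffunE.
  apply: (@leq_trans (#|[set c : 'Z_q | (s * c == 0)%R]| ^ d)); last first.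
    by case: (d) => // d'; rewrite leq_exp2r // card_annihilator.
  rewrite -(card_imset _ f_inj) -[X in (_ <= _ ^ X)%N]card_ord -card_ffun_on.
  apply/subset_leq_card/subsetP => _ /imsetP [v vK ->].
  by apply/ffun_onP => i; rewrite ffunE inE; move: vK; rewrite inE => /forallP.
have card_V : #|{: 'rV['Z_q]_d}| = (q ^ d)%N.
  by rewrite card_mx mul1n card_ord Zp_cast.
have corr y y' : `|\sum_x chi (s * sqnorm (x - y) - s * sqnorm (x - y'))| <=
    (y - y' \in K)%:R * q%:R ^+ d.
  have phase (x : 'rV['Z_q]_d) : chi (s * sqnorm (x - y) - s * sqnorm (x - y')) =
      chi (s * (sqnorm y - sqnorm y')) *
      chi (\sum_(i < d) x 0 i * (2 * (s * (y' 0 i - y 0 i)))).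
    rewrite -chiD -mulrBr sqnorm_sub_sub mulrDr mulr_sumr; congr (chi (_ + _)).
    by apply: eq_bigr => i _; ring.
  rewrite (eq_bigr _ (fun x _ => phase x)) -mulr_sumr normrM chi_norm mul1r.
  case: (boolP (y - y' \in K)) => [yK | ].
    rewrite mul1r; apply: le_trans (ler_norm_sum _ _ _) _.
    under eq_bigr do rewrite chi_norm.
    by rewrite sumr_const -natrX -card_V.
  rewrite inE => /forallPn [i yi].
  (* The basis vector [delta_mx 0 i] isolates the coordinate where [s * (y - y')] is nonzero. *)
  rewrite (@sum_nontrivial_character _ _ (delta_mx 0 i)) ?normr0 ?mul0r //.
    by move=> x x'; rewrite -chiD -big_split /=; under [in RHS]eq_bigr do rewrite -mulrDl; under [in LHS]eq_bigr do rewrite mxE.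
  apply: contra yi => /eqP /chi_faithful.
  rewrite (bigD1 i) //= mxE !eqxx mul1r big1 ?addr0; last first.
    by move=> j ji; rewrite mxE (negbTE ji) andbF mul0r.
  set a := s * _ => a2; rewrite !mxE.
  have -> : s * (y 0 i - y' 0 i) = - a by rewrite /a -mulrN opprB.
  (* Oddness of [q] removes the factor 2: [q.+1] is even, so [2 * a = 0] gives [a *+ q.+1 = 0],
     while [a *+ q = 0]. *)
  have : a *+ (q.+1) = 0.
    have -> : q.+1 = (2 * q./2.+1)%N.
      by rewrite mul2n doubleS -[in LHS](odd_double_half q) q_odd.
    by rewrite mulrnA -[a *+ 2]mulr_natl a2 mul0rn.
  by rewrite mulrS -[a *+ q]mulr_natl pchar_Zp // mul0r addr0 oppr_eq0 => /eqP.
have sum_b : \sum_x b x ^+ 2 <= #|E|%:R * (gcdn s q * q)%:R ^+ d.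
  have b2E : \sum_x b x ^+ 2 = \sum_(y in E) \sum_(y' in E)
      \sum_x chi (s * sqnorm (x - y) - s * sqnorm (x - y')).
    rewrite exchange_big /=; under [RHS]eq_bigr do rewrite exchange_big /=.
    rewrite [RHS]exchange_big /=; apply: eq_bigr => x _.
    rewrite /b normCK rmorph_sum mulr_sumr; apply: eq_bigr => y' _.
    by rewrite mulr_suml; apply: eq_bigr => y _ /=; rewrite chi_conj -chiD.
  (* A nonnegative sum equals its modulus, so the triangle inequality applies to its complex
     expansion. *)
  rewrite -[leLHS]ger0_norm; last by apply: sumr_ge0 => x _; rewrite exprn_ge0 ?normr_ge0.
  rewrite b2E; apply: le_trans (ler_norm_sum _ _ _) _.
  rewrite mulr_natl -sumr_const; apply: ler_sum => y _.
  apply: le_trans (ler_norm_sum _ _ _) _.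
  apply: (@le_trans _ _ (\sum_(y' in E) (y - y' \in K)%:R * q%:R ^+ d)).
    by apply: ler_sum => y' _; apply: corr.
  rewrite -mulr_suml natrM exprMn ler_wpM2r ?exprn_ge0 // -natr_sum -natrX ler_nat.
  apply: leq_trans card_K.
  rewrite -sum1_card [X in (_ <= X)%N]big_mkcond /=.
  (* For fixed [y], the map [y' |-> y - y'] is injective, so at most [#|K|] values of [y']
     contribute. *)
  rewrite [X in (_ <= X)%N](reindex_inj (inj_comp (addrI y) oppr_inj)) /=.
  by rewrite big_mkcond leq_sum // => y' _; case: ifP.
have b_ge0 x : 0 <= b x by apply: normr_ge0.
have le_b : `|\sum_(x in E) \sum_(y in E) chi (s * sqnorm (x - y))| <= \sum_(x in E) b x.
  exact: ler_norm_sum.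
apply: le_trans (lerXn2r _ _ _ le_b) _; rewrite ?nnegrE ?sumr_ge0 //.
apply: le_trans (sqr_sum_le_card E b_ge0) _.
rewrite expr2 -mulrA ler_wpM2l //; apply: le_trans sum_b.
by rewrite [leRHS](bigID (mem E)) /= lerDl sumr_ge0 // => x _; rewrite exprn_ge0.
Qed.

(** * From a missing distance to a bound on |E| *)

(** The cofactor [q %/ g] exceeds 1, so it is at least its smallest prime factor, which is at least
    [P]. *)
Lemma dvdn_mul_leq (q g P : nat) :
  (0 < q)%N -> (forall r, prime r -> (r %| q)%N -> (P <= r)%N) ->
  (g %| q)%N -> (g < q)%N -> (g * P <= q)%N.
Proof.
move=> q_gt0 P_le g_q g_lt.
have g_gt0 : (0 < g)%N by apply: dvdn_gt0 g_q.
rewrite -[X in (_ <= X)%N](divnK g_q) mulnC leq_mul2r; apply/orP; right.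
have qg_gt1 : (1 < q %/ g)%N by rewrite ltn_divRL // mul1n.
apply: leq_trans (pdiv_leq (ltnW qg_gt1)); apply: P_le; first exact: pdiv_prime.
by apply: dvdn_trans (pdiv_dvd _) (dvdn_div g_q).
Qed.

(** Squaring removes the half-integer exponent; the resulting inequality of naturals passes from
    [algC] to the real field of the theorem. *)
Lemma card_le_of_missing_distance (q d P : nat) (E : {set 'rV['Z_q]_d}) (t : 'Z_q) :
  (1 < q)%N -> odd q -> (2 <= d)%N ->
  (forall r, prime r -> (r %| q)%N -> (P <= r)%N) ->
  t \notin distance_set E ->
  (#|E| ^ 2 * P ^ (d - 2) <= (q ^ d * (tau q).-1) ^ 2)%N.
Proof.
move=> q_gt1 q_odd d_ge2 P_le t_notin; have q_gt0 := ltnW q_gt1.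
have [chi [chiD chi_norm chi_faithful]] := exists_faithful_character q.
have chi0 : chi 0 = 1 := unit_character0 chiD chi_norm.
pose B s := \sum_(x in E) \sum_(y in E) chi (s * sqnorm (x - y)).
have B0 : B 0 = #|E|%:R ^+ 2.
  rewrite /B; under eq_bigr do under eq_bigr do rewrite mul0r chi0.
  by rewrite !sumr_const -mulrnA -natrX mulnn.
have twisted_sum : \sum_s chi (- (s * t)) * B s = 0.
  under eq_bigr => s _ do rewrite mulr_sumr; rewrite exchange_big big1 // => x xE.
  under eq_bigr => s _ do rewrite mulr_sumr; rewrite exchange_big big1 // => y yE.
  under eq_bigr => s _ do rewrite -chiD addrC -mulrBr.
  (* For fixed [x] and [y] this is a character in [s]; its value at [s = 1] differs from 1 because
     [t] is not the distance from [x] to [y]. *)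
  apply: (@sum_nontrivial_character _ _ 1); first by move=> s s'; rewrite mulrDl chiD.
  rewrite mul1r; apply: contra t_notin => /eqP/chi_faithful/eqP; rewrite subr_eq0 => /eqP <-.
  by apply/imset2P; exists x y.
pose r : algC := sqrtC (P ^ (d - 2))%:R.
have r_ge0 : 0 <= r by rewrite sqrtC_ge0.
have B_le (s : 'Z_q) : s != 0 -> `|B s| * (q%:R * r) <= #|E|%:R * q%:R ^+ d * (gcdn s q)%:R.
  move=> s0; set g := gcdn s q.
  have rhs_ge0 : 0 <= #|E|%:R * q%:R ^+ d * g%:R :> algC by rewrite !mulr_ge0 ?exprn_ge0.
  rewrite -(@ler_pXn2r _ 2) ?nnegrE ?rhs_ge0 ?mulr_ge0 //.
  have g_lt : (g < q)%N.
    have s_gt0 : (0 < s)%N by rewrite lt0n.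
    apply: leq_ltn_trans (dvdn_leq s_gt0 (dvdn_gcdl s q)) _.
    by rewrite -[X in (_ < X)%N](Zp_cast q_gt1) ltn_ord.
  have gP := dvdn_mul_leq q_gt0 P_le (dvdn_gcdr s q) g_lt.
  (* The left side equals [g ^ 2 * q ^ d.+2 * (g * P) ^ (d - 2)], and [g * P <= q]. *)
  have pow_le : ((g * q) ^ d * (q ^ 2 * P ^ (d - 2)) <= (q ^ d * g) ^ 2)%N.
    have -> : ((g * q) ^ d * (q ^ 2 * P ^ (d - 2)) = g ^ 2 * q ^ d.+2 * (g * P) ^ (d - 2))%N.
      by rewrite -{1 3}(subnK d_ge2) !(expnMn, expnS, expnD) expn0; ring.
    have -> : ((q ^ d * g) ^ 2 = g ^ 2 * q ^ d.+2 * q ^ (d - 2))%N.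
      by rewrite -{1 2}(subnK d_ge2) !(expnMn, expnS, expnD) expn0; ring.
    by rewrite leq_mul2l; case: (d - 2)%N => [|e]; rewrite ?orbT // leq_exp2r ?gP ?orbT.
  rewrite !exprMn sqrtCK.
  apply: (@le_trans _ _ (#|E|%:R ^+ 2 * (g * q)%:R ^+ d * (q%:R ^+ 2 * (P ^ (d - 2))%:R))).
    by rewrite ler_wpM2r ?mulr_ge0 ?exprn_ge0 // norm_distance_sum_le.
  rewrite -!mulrA ler_wpM2l ?exprn_ge0 // -!natrX -!natrM ler_nat.
  move: pow_le; rewrite [((_ * g) ^ 2)%N]expnMn -!mulnn -!mulnA => pow_le.
  by rewrite leq_mul2l pow_le orbT.
have q_pos : 0 < q%:R :> algC by rewrite ltr0n.
have main : #|E|%:R ^+ 2 * (q%:R * r) <= #|E|%:R * q%:R ^+ d * ((tau q).-1 * q)%:R.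
  (* Isolate the term [s = 0], which is [B 0], in the vanishing twisted sum. *)
  have -> : #|E|%:R ^+ 2 = `|\sum_(s | s != 0) chi (- (s * t)) * B s|.
    rewrite -[LHS]ger0_norm ?exprn_ge0 // -B0 -normrN; congr `|_|.
    apply/eqP; rewrite eq_sym -addr_eq0 addrC; apply/eqP.
    by rewrite -[RHS]twisted_sum [RHS](bigD1 0) //= mul0r oppr0 chi0 mul1r.
  apply: le_trans (ler_wpM2r _ (ler_norm_sum _ _ _)) _; first by rewrite mulr_ge0.
  rewrite mulr_suml.
  apply: (@le_trans _ _ (\sum_(s : 'Z_q | s != 0) #|E|%:R * q%:R ^+ d * (gcdn s q)%:R)).
    by apply: ler_sum => s s0; rewrite normrM chi_norm mul1r B_le.
  rewrite -mulr_sumr ler_wpM2l ?mulr_ge0 ?exprn_ge0 // -natr_sum ler_nat.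
  exact: sum_gcd_le.
have [-> // | E_gt0] := posnP #|E|.
have {main} : #|E|%:R * r <= (q ^ d * (tau q).-1)%:R.
  rewrite -(ler_pM2l (x := #|E|%:R * q%:R)) ?mulr_gt0 ?ltr0n //.
  move: main; rewrite !natrM natrX; congr (_ <= _).
    by rewrite expr2 -!mulrA; congr (_ * _); rewrite mulrCA.
  by rewrite -!mulrA; congr (_ * _); rewrite [RHS]mulrC -!mulrA.
rewrite -(@ler_pXn2r _ 2) ?nnegrE ?mulr_ge0 //.
by rewrite exprMn sqrtCK -!natrX -natrM ler_nat.
Qed.

(** * The theorem with C = 1 *)

Theorem theorem1p5 (R : realType) (d : nat) (d_gt2 : (2 < d)%N) :
  exists C : R, 0 < C /\
    forall (q k : nat) (k_gt0 : (0 < k)%N) (p alpha : 'I_k -> nat),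
      let p1 := p (Ordinal k_gt0) in
      (forall i : 'I_k, prime (p i)) ->
      (2 < p1)%N ->
      (forall i j : 'I_k, (i < j)%N -> (p i < p j)%N) ->
      (forall i : 'I_k, (0 < alpha i)%N) ->
      q = (\prod_(i < k) p i ^ alpha i)%N ->
      forall E : {set 'rV['Z_q]_d},
        C * (tau q)%:R * q%:R ^+ d * p1%:R `^ (- ((d%:R - 2) / 2)) <= #|E|%:R ->
        distance_set E = [set: 'Z_q].
Proof.
exists 1; split=> // q k k_gt0 p alpha p1 p_prime p1_gt2 p_incr alpha_gt0 q_prod E.
have P_le r : prime r -> (r %| q)%N -> (p1 <= r)%N.
  move=> r_prime; rewrite q_prod Euclid_dvd_prod // big_has_cond => /hasP [i _ /= r_pi].
  have -> : r = p i.
    by move: r_pi; rewrite Euclid_dvdX // alpha_gt0 andbT dvdn_prime2 // => /eqP.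
  case: (posnP i) => [i0 | i_gt0]; last by rewrite ltnW // p_incr.
  by rewrite /p1 (_ : Ordinal k_gt0 = i) //; apply: val_inj.
have p1_q : (p1 %| q)%N.
  rewrite q_prod (bigD1 (Ordinal k_gt0)) //= dvdn_mulr // -{1}[p1]expn1.
  by rewrite dvdn_exp2l.
have q_gt0 : (0 < q)%N.
  by rewrite q_prod prodn_gt0 // => i; rewrite expn_gt0 prime_gt0.
have q_gt1 : (1 < q)%N by rewrite (leq_trans (ltnW p1_gt2)) // dvdn_leq.
have q_odd : odd q.
  apply/negPn/negP => q_even; have := P_le 2%N isT.
  by rewrite dvdn2 q_even leqNgt p1_gt2 => /(_ isT).
have p1_pos : 0 < p1%:R :> R by rewrite ltr0n (ltn_trans _ p1_gt2).
have tau_gt0 : (0 < tau q)%N by rewrite /tau; case: divisors (divisor1 q).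
rewrite mul1r powRN; set y := _ `^ _.
have y_gt0 : 0 < y by apply: powR_gt0.
(* Here [y] is the real power of [p1] with exponent (d - 2) / 2. *)
have y2 : y ^+ 2 = p1%:R ^+ (d - 2).
  rewrite -powR_mulrn ?powR_ge0 // -powRrM -powR_mulrn ?ltW //.
  by rewrite divfK ?pnatr_eq0 // natrB // ltnW.
rewrite ler_pdivrMr // => E_large.
apply/setP => t; rewrite in_setT; apply/negPn/negP => t_notin.
have := card_le_of_missing_distance q_gt1 q_odd (ltnW d_gt2) P_le t_notin.
apply/negP; rewrite -ltnNge -(ltr_nat R) natrM !natrX -y2 -exprMn.
(* Strictness comes from [(tau q).-1 < tau q], so a non-strict lower bound on [#|E|] suffices for
   the contradiction. *)
apply: (@lt_le_trans _ _ (((tau q)%:R * q%:R ^+ d) ^+ 2)).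
  rewrite ltr_pXn2r ?nnegrE ?mulr_ge0 ?exprn_ge0 //.
  by rewrite -natrX -natrM ltr_nat mulnC ltn_pmul2r ?expn_gt0 ?q_gt0 // prednK.
by rewrite ler_pXn2r ?nnegrE ?mulr_ge0 ?exprn_ge0 // ltW.
Qed.
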